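(* Let $\mathbb{H}_1,\mathbb{H}_2$ be complex Hilbert spaces and let $T=\begin{pmatrix}A&B\\ C&D\end{pmatrix}$ be the operator on $\mathbb{H}_1\oplus\mathbb{H}_2$ with $A\in B(\mathbb{H}_1)$, $B\in B(\mathbb{H}_2,\mathbb{H}_1)$, $C\in B(\mathbb{H}_1,\mathbb{H}_2)$, $D\in B(\mathbb{H}_2)$. Then $$w(T)\le\frac12\left[w(A)+w(D)+\sqrt{(w(A)-w(D))^2+\|B\|^2+\|C\|^2+2w(CB)}\right].$$
   Context: $B(\mathbb{H},\mathbb{K})$ is the set of bounded linear operators from $\mathbb{H}$ into $\mathbb{K}$, $B(\mathbb{H})=B(\mathbb{H},\mathbb{H})$, and $\|\cdot\|$ is the operator norm. The numerical radius of a bounded operator $S$ on a complex Hilbert space $\mathbb{H}$ is $w(S)=\sup\{|\langle Sx,x\rangle| : x\in\mathbb{H},\ \|x\|=1\}$. *)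

(* Defs.v *)
From HB Require Import structures.
From mathcomp Require Import all_boot all_order all_algebra.
From mathcomp Require Import all_classical all_reals all_analysis.
From mathcomp Require Import complex.
Set Implicit Arguments.
Unset Strict Implicit.
Unset Printing Implicit Defensive.
Import Order.TTheory GRing.Theory Num.Theory.
Import numFieldNormedType.Exports.

Local Open Scope classical_set_scope.
Local Open Scope ring_scope.
Local Open Scope complex_scope.

(* [{dot H for conj}] is the library's type of positive definite Hermitian
   forms, linear in the first argument and conjugate-linear in the second. *)
HB.mixin Record NormedModule_isHilbert (R : realType) H
    & NormedModule R[i] H := {
  inner : {dot H for @Num.conj R[i]} ;
  norm_innerE : forall x : H, `|x| = sqrtC (inner x x)
}.

#[short(type="hilbertType")]
HB.structure Definition Hilbert (R : realType) :=
  {H of CompleteNormedModule R[i] H & NormedModule_isHilbert R H}.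

Section operators.
Context {R : realType}.

Definition bounded_operator (H K : hilbertType R) (f : H -> K) : Prop :=
  exists M : R, forall x, `|f x| <= M%:C * `|x|.

(* Norms take values in [R[i]], hence the real parts below.  The unit ball,
   rather than the unit sphere, gives the right value 0 on the zero space. *)
Definition opnorm (H K : hilbertType R) (f : H -> K) : R :=
  sup [set complex.Re `|f x| | x in [set x : H | `|x| <= 1]].

(* On the zero space the unit sphere is empty and the value is [sup set0], i.e.
   0. *)
Definition numerical_radius (H : hilbertType R) (S : H -> H) : R :=
  sup [set complex.Re `|inner (S x) x| | x in [set x : H | `|x| = 1]].

End operators.


Section dot_norm.
Context {C : numClosedFieldType} {U : lmodType C}.
Variable form : {dot U for @Num.conj C}.

(* The library's [CauchySchwarz] is restricted to finite dimension. *)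
Lemma dot_CauchySchwarz (u v : U) :
  `|form u v| ^+ 2 <= form u u * form v v.
Proof.
have [->|v0] := eqVneq v 0; first by rewrite !linear0r normr0 expr0n.
pose a := form u v / form v v; pose w := u - a *: v.
have wv : form w v = 0.
  by rewrite linearBl/= linearZl_LR/= divfK ?dnorm_eq0 ?subrr.
have -> : u = w + a *: v by rewrite subrK.
rewrite linearDl/= wv add0r linearZl_LR/= normrM (ger0_norm (dnorm_ge0 _ _)).
rewrite exprMn hnormDd/=; last by rewrite linearZr_LR/= wv mulr0.
rewrite dnormZ mulrDl expr2 mulrA lerDr.
by rewrite mulr_ge0 ?dnorm_ge0.
Qed.

Lemma dot_triangle (u v : U) :
  sqrtC (form (u + v) (u + v)) <= sqrtC (form u u) + sqrtC (form v v).
Proof.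
have uv : `|form u v| <= sqrtC (form u u) * sqrtC (form v v).
  rewrite -(sqrCK (normr_ge0 _)) -sqrtCM ?nnegrE ?dnorm_ge0//.
  rewrite ler_sqrtC ?nnegrE ?mulr_ge0 ?dnorm_ge0 ?exprn_ge0//.
  exact: dot_CauchySchwarz.
have h0 : 0 <= sqrtC (form u u) + sqrtC (form v v).
  by rewrite addr_ge0 ?sqrtC_ge0 ?dnorm_ge0.
rewrite -(ler_pXn2r (ltn0Sn 1)) ?nnegrE ?sqrtC_ge0 ?dnorm_ge0//.
rewrite sqrrD !sqrtCK dnormD/= addrAC lerD2r lerD2l.
have -> : form u v + (form u v)^* = 'Re (form u v) *+ 2.
  by rewrite -mulr_natr ReE divfK ?pnatr_eq0.
by rewrite lerMn2r/= (le_trans _ uv)// leif_Re_Creal.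
Qed.

Lemma dot_normZ (a : C) (u : U) :
  sqrtC (form (a *: u) (a *: u)) = `|a| * sqrtC (form u u).
Proof.
by rewrite dnormZ sqrtCM ?nnegrE ?exprn_ge0 ?dnorm_ge0// sqrCK.
Qed.

Lemma dot_norm_eq0 (u : U) : sqrtC (form u u) = 0 -> u = 0.
Proof. by move=> /eqP; rewrite sqrtC_eq0 dnorm_eq0 => /eqP. Qed.

End dot_norm.

(* The Hilbert sum [H1 (+) H2].  It is an alias of the product type, so as not
   to inherit the max norm of the product. *)
Definition hsum (R : realType) (H1 H2 : hilbertType R) : Type := (H1 * H2)%type.

Section hsum.
Context {R : realType} {H1 H2 : hilbertType R}.

HB.instance Definition _ := GRing.Lmodule.on (hsum H1 H2).

Definition hsum_inner (x y : hsum H1 H2) : R[i] :=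
  inner x.1 y.1 + inner x.2 y.2.

Fact hsum_inner_bilinear :
  bilinear_for ( *%R : GRing.Scale.law _ _)
    (@Num.conj R[i] \; *%R : GRing.Scale.law _ _) hsum_inner.
Proof.
split=> [u a x y|u a x y]; rewrite /hsum_inner/=.
  by rewrite !linearPl/= mulrDr addrACA.
by rewrite !linearPr/= mulrDr addrACA.
Qed.

HB.instance Definition _ := bilinear_isBilinear.Build R[i] (hsum H1 H2)
  (hsum H1 H2) R[i] _ _ hsum_inner hsum_inner_bilinear.

Fact hsum_inner_hermitian (x y : hsum H1 H2) :
  hsum_inner x y = (-1) ^+ false * Num.conj (hsum_inner y x).
Proof.
rewrite /hsum_inner rmorphD/= mulrDr.
by rewrite -!(@hermitian_subproof _ _ false (@Num.conj R[i]) inner).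
Qed.

HB.instance Definition _ := isHermitianSesquilinear.Build R[i] (hsum H1 H2)
  false (@Num.conj R[i]) hsum_inner hsum_inner_hermitian.

Fact hsum_inner_gt0 (x : hsum H1 H2) : x != 0 -> 0 < hsum_inner x x.
Proof.
rewrite /hsum_inner => x0; rewrite lt_def addr_ge0 ?dnorm_ge0// andbT.
apply: contra x0; rewrite paddr_eq0 ?dnorm_ge0// !dnorm_eq0.
by case: x => x1 x2 /= /andP[/eqP-> /eqP->].
Qed.

HB.instance Definition _ := isDotProduct.Build R[i] (hsum H1 H2)
  hsum_inner hsum_inner_gt0.

HB.instance Definition _ := Lmodule_isNormed.Build R[i] (hsum H1 H2)
  (dot_triangle hsum_inner) (dot_normZ hsum_inner)
  (@dot_norm_eq0 _ _ hsum_inner).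

Fact hsum_normE (x : hsum H1 H2) : `|x| = sqrtC (`|x.1| ^+ 2 + `|x.2| ^+ 2).
Proof.
by rewrite [RHS](_ : _ = sqrtC (hsum_inner x x))// !norm_innerE !sqrtCK. Qed.

Fact hsum_norm_fst (x : hsum H1 H2) : `|x.1| <= `|x|.
Proof.
rewrite hsum_normE -{1}(sqrCK (normr_ge0 x.1)).
by rewrite ler_sqrtC ?nnegrE ?addr_ge0 ?exprn_ge0// lerDl exprn_ge0.
Qed.

Fact hsum_norm_snd (x : hsum H1 H2) : `|x.2| <= `|x|.
Proof.
rewrite hsum_normE -{1}(sqrCK (normr_ge0 x.2)).
by rewrite ler_sqrtC ?nnegrE ?addr_ge0 ?exprn_ge0// lerDr exprn_ge0.
Qed.

Fact hsum_norm_le (x : hsum H1 H2) : `|x| <= `|x.1| + `|x.2|.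
Proof.
have h0 : 0 <= `|x.1| + `|x.2| by rewrite addr_ge0.
rewrite hsum_normE -(sqrCK h0).
rewrite ler_sqrtC ?nnegrE ?addr_ge0 ?exprn_ge0// sqrrD addrAC lerDl.
by rewrite mulrn_wge0 ?mulr_ge0.
Qed.

Fact hsum_complete (F : set_system (hsum H1 H2)) :
  ProperFilter F -> cauchy F -> cvg F.
Proof.
move=> FF /cauchy_ballP Fc.
have cF1 : cauchy ((fun x : hsum H1 H2 => x.1 : H1) @ F).
  apply/cauchy_ballP => e e0; rewrite near_map2.
  apply: filterS (Fc e e0) => -[x y] /=; rewrite -!ball_normE/=.
  by apply: le_lt_trans; exact: (hsum_norm_fst (x - y)).
have cF2 : cauchy ((fun x : hsum H1 H2 => x.2 : H2) @ F).
  apply/cauchy_ballP => e e0; rewrite near_map2.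
  apply: filterS (Fc e e0) => -[x y] /=; rewrite -!ball_normE/=.
  by apply: le_lt_trans; exact: (hsum_norm_snd (x - y)).
have /cauchy_cvg/cvg_ex[/= l1 Fl1] := cF1.
have /cauchy_cvg/cvg_ex[/= l2 Fl2] := cF2.
apply/cvg_ex; exists ((l1, l2) : hsum H1 H2).
apply/cvgrPdist_lt => e e0.
have e20 : 0 < e / 2 by rewrite divr_gt0.
near=> x; apply: (le_lt_trans (hsum_norm_le _)) => /=.
rewrite (splitr e) ltrD//.
- by near: x; move/cvgrPdist_lt : Fl1; exact.
- by near: x; move/cvgrPdist_lt : Fl2; exact.
Unshelve. all: by end_near. Qed.

HB.instance Definition _ := Uniform_isComplete.Build (hsum H1 H2) hsum_complete.

HB.instance Definition _ := NormedModule_isHilbert.Build R (hsum H1 H2)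
  (fun x => erefl `|x|).

End hsum.

Section block.
Context {R : realType} {H1 H2 : hilbertType R}.
Variables (A : {linear H1 -> H1}) (B : {linear H2 -> H1}).
Variables (C : {linear H1 -> H2}) (D : {linear H2 -> H2}).

Definition block_op (x : hsum H1 H2) : hsum H1 H2 :=
  (A x.1 + B x.2, C x.1 + D x.2).

Fact block_op_linear : linear block_op.
Proof.
move=> a x y; rewrite /block_op/= !linearP/=.
by congr pair; rewrite /= scalerDr addrACA.
Qed.

HB.instance Definition _ := GRing.isLinear.Build R[i] (hsum H1 H2)
  (hsum H1 H2) _ block_op block_op_linear.

Fact bounded_block_op :
  bounded_operator A -> bounded_operator B ->
  bounded_operator C -> bounded_operator D -> bounded_operator block_op.
Proof.
move=> [a Aa] [b Bb] [c Cc] [d Dd].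
exists (`|a| + `|b| + (`|c| + `|d|)) => x.
have wk (K L : hilbertType R) (f : K -> L) (m : R) (u : K) :
    `|f u| <= m%:C * `|u| -> `|u| <= `|x| -> `|f u| <= `|m|%:C * `|x|.
  move=> fu ux; apply: (le_trans fu); apply: (@le_trans _ _ (`|m|%:C * `|u|)).
    by rewrite ler_wpM2r// lecR ler_norm.
  by rewrite ler_wpM2l// ler0c.
apply: (le_trans (hsum_norm_le _)) => /=; rewrite !rmorphD/= !mulrDl.
have x1 := hsum_norm_fst x; have x2 := hsum_norm_snd x.
rewrite lerD// (le_trans (ler_normD _ _))// lerD//; exact: wk.
Qed.

End block.

(* Main.v *)
Require Import Defs.
From mathcomp Require Import all_boot all_order all_algebra.
From mathcomp Require Import all_classical all_reals all_analysis.
From mathcomp Require Import complex.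
From mathcomp Require Import ring.
Import Order.TTheory GRing.Theory Num.Theory.
Import numFieldNormedType.Exports.
Local Open Scope ring_scope.

(** For a unit vector [x = (u, v)] of the Hilbert sum, the number [<Tx, x>] is
    the sum of [<Au, u>], [<Dv, v>] and the off-diagonal part
    [<Bv, u> + <Cu, v>].  With [s = |u|] and [t = |v|], the first two are at
    most [w(A) s^2] and [w(D) t^2].  If the off-diagonal part is at most
    [k s t] with [k^2 = |B|^2 + |C|^2 + 2 w(CB)], then [|<Tx, x>|] is bounded
    by the value at [(s, t)] of a real quadratic form, and the right-hand side
    of the theorem is the largest eigenvalue of that form
    ([binary_quadratic_form_le]).

    The bound on the off-diagonal part ([norm_off_diagonal_le]) is clearest
    with the adjoint of [C]: put [y = C^* v], so that the part equals
    [<Bv, u> + <u, y>].  Up to phases this is the inner product of [u] with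
    [Bv + y], so Cauchy-Schwarz gives at most [|u| |Bv + y|], and expanding the
    square of the second norm leaves the cross term
    [2 |<Bv, y>| = 2 |<CBv, v>|], which the numerical radius of [CB] controls
    ([dot_sum_le]).

    Only the values of the functional [<C _, v>] at the two vectors [u] and
    [Bv] enter this argument.  It is therefore enough to represent the
    functional on the plane that they span, where the Riesz theorem is an
    explicit formula that needs no completeness ([Riesz_two_points]). *)

(** * Inner products and linear functionals *)

Lemma exists_phase {C : numClosedFieldType} (p : C) :
  exists2 t : C, `|t| = 1 & t * p = `|p|.
Proof.
have [->|p0] := eqVneq p 0.
  by exists 1; rewrite ?normr1// mulr0 normr0.
exists (`|p| / p); last by rewrite divfK.
by rewrite normf_div normr_id divff// normr_eq0.
Qed.

(** The representing vector is the sum of [(phi e)^* / <e, e> *: e] over an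
    orthogonal basis of the span of [u] and [x], here [u] and the component [z]
    of [x] orthogonal to it.  It has [<y, y> = phi y], and the bound on [phi]
    at [y] itself then bounds its norm.  If [u] or [z] vanishes, division by
    zero makes its term zero, so no case distinction on the dimension arises. *)
Lemma Riesz_two_points {C : numClosedFieldType} {U : lmodType C}
    (form : {dot U for @Num.conj C}) (phi : U -> C) (N : C) (u x : U) :
  scalar phi -> 0 <= N -> (forall w, `|phi w| ^+ 2 <= N * form w w) ->
  exists y, [/\ form u y = phi u, form x y = phi x & form y y <= N].
Proof.
move=> phiP N0 phiN.
have phi0 : phi 0 = 0.
  have := phiP 1 0 0.
  by rewrite scaler0 addr0 mul1r -{1}[phi 0]addr0 => /addrI.
pose q z := ((phi z)^* / form z z) *: z.
have qE z : form z (q z) = phi z.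
  have [->|z0] := eqVneq z 0; first by rewrite linear0l phi0.
  rewrite linearZr_LR/= rmorphM fmorphV/= conjCK conj_Creal ?divfK ?dnorm_eq0//.
  by rewrite ger0_real// dnorm_ge0.
pose a := form x u / form u u; pose z := x - a *: u.
have zu : form z u = 0.
  have [->|u0] := eqVneq u 0; first by rewrite linear0r.
  by rewrite linearBl/= linearZl_LR/= divfK ?dnorm_eq0 ?subrr.
have uz : form u z = 0 by rewrite hermC/= zu rmorph0 mulr0.
have uy : form u (q u + q z) = phi u.
  by rewrite linearDr/= qE linearZr_LR/= uz mulr0 addr0.
have zy : form z (q u + q z) = phi z.
  by rewrite linearDr/= qE linearZr_LR/= zu mulr0 add0r.
exists (q u + q z); split=> //.
  have -> : x = a *: u + z by rewrite addrC subrK.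
  by rewrite linearDl/= linearZl_LR/= uy zy phiP.
set y := q u + q z.
have yy : form y y = phi y.
  have -> : phi y = (phi u)^* / form u u * phi u + (phi z)^* / form z z * phi z.
    rewrite phiP; congr (_ + _).
    by rewrite -[q z]addr0 phiP phi0 addr0.
  by rewrite {1}/y linearDl/= !linearZl_LR/= uy zy.
have [->|y0] := eqVneq y 0; first by rewrite linear0l.
have y_gt0 : 0 < form y y by rewrite dnorm_gt0.
rewrite -(ler_pM2r y_gt0); apply: le_trans (phiN y).
by rewrite -yy ger0_norm ?dnorm_ge0.
Qed.

(** Multiplying [x] and [y] by phases makes both inner products with [u]
    nonnegative, so that their sum is a single inner product to which
    Cauchy-Schwarz applies; the phases leave [<x, x>], [<y, y>] and [|<x, y>|]
    unchanged. *)
Lemma dot_sum_le {C : numClosedFieldType} {U : lmodType C}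
    (form : {dot U for @Num.conj C}) (u x y : U) :
  (`|form x u| + `|form y u|) ^+ 2 <=
  form u u * (form x x + form y y + 2 * `|form x y|).
Proof.
have [s s1 sx] := exists_phase (form x u).
have [t t1 ty] := exists_phase (form y u).
have -> : `|form x u| + `|form y u| = form (s *: x + t *: y) u.
  by rewrite linearDl/= !linearZl_LR/= sx ty.
have E : 0 <= form (s *: x + t *: y) u.
  by rewrite linearDl/= !linearZl_LR/= sx ty addr_ge0.
rewrite -[X in X ^+ 2]ger0_norm//; apply: le_trans (dot_CauchySchwarz _ _ _) _.
rewrite mulrC ler_wpM2l ?dnorm_ge0// dnormD !dnormZ s1 t1 expr1n !mul1r.
rewrite lerD2l linearZl_LR/= linearZr_LR/=.
set d := s * _.
have -> : `|form x y| = `|d| by rewrite /d !normrM norm_conjC s1 t1 !mul1r.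
have -> : d + d^* = 'Re d *+ 2 by rewrite -mulr_natr ReE divfK ?pnatr_eq0.
by rewrite mulr_natl lerMn2r/= leif_Re_Creal.
Qed.

(** This is [dot_sum_le] for the vector representing [phi], stated for the
    functional so that [phi] may come from an operator without invoking its
    adjoint. *)
Lemma dot_functional_sum_le {C : numClosedFieldType} {U : lmodType C}
    (form : {dot U for @Num.conj C}) (phi : U -> C) (N : C) (u x : U) :
  scalar phi -> 0 <= N -> (forall w, `|phi w| ^+ 2 <= N * form w w) ->
  `|form x u + phi u| ^+ 2 <= form u u * (form x x + N + 2 * `|phi x|).
Proof.
move=> phiP N0 phiN.
have [y [uy xy yN]] := Riesz_two_points form phi N u x phiP N0 phiN.
apply: (@le_trans _ _ ((`|form x u| + `|form y u|) ^+ 2)).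
  rewrite ler_pXn2r ?nnegrE ?addr_ge0//.
  by rewrite [form y u]hermC/= expr0 mul1r norm_conjC uy ler_normD.
apply: (le_trans (dot_sum_le _ _ _ _)).
by rewrite xy ler_wpM2l ?dnorm_ge0// lerD2r lerD2l.
Qed.

(** * Norm and numerical radius of bounded operators *)

Local Open Scope complex_scope.

(** Empty and unbounded sets are included: their [sup] is 0 by convention. *)
Lemma sup_of_ge0 {R : realType} (E : set R) :
  (forall y, E y -> 0 <= y) -> 0 <= sup E.
Proof.
move=> E0; have [Es|/sup_out->//] := pselect (has_sup E).
by have [[y Ey] Eub] := Es; apply: le_trans (E0 y Ey) _; exact: ub_le_sup.
Qed.

Lemma dot_normM {R : realType} {H : hilbertType R} (x : H) :
  inner x x = `|x| ^+ 2.
Proof. by rewrite norm_innerE sqrtCK. Qed.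

Lemma norm_innerM {R : realType} {H : hilbertType R} (x y : H) :
  `|inner x y| <= `|x| * `|y|.
Proof.
rewrite -(@ler_pXn2r _ 2) ?nnegrE ?mulr_ge0// exprMn -!dot_normM.
exact: dot_CauchySchwarz.
Qed.

Lemma Re_norm {R : realType} {V : normedZmodType R[i]} (x : V) :
  (complex.Re `|x|)%:C = `|x|.
Proof. by rewrite RRe_real// ger0_real. Qed.

Lemma Re_norm_ge0 {R : realType} {V : normedZmodType R[i]} (x : V) :
  0 <= complex.Re `|x|.
Proof. rewrite -lecR Re_norm; exact: normr_ge0. Qed.

Lemma numerical_radius_ge0 {R : realType} {H : hilbertType R} (S : H -> H) :
  0 <= numerical_radius S.
Proof. by apply: sup_of_ge0 => _ [x _ <-]; exact: Re_norm_ge0. Qed.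

(** Both sides are homogeneous of degree 2 in [x], so the case of unit vectors
    suffices.  Boundedness of [S] is what makes the [sup] an upper bound. *)
Lemma norm_inner_le_numerical_radius {R : realType} {H : hilbertType R}
    (S : {linear H -> H}) (x : H) : bounded_operator S ->
  `|inner (S x) x| <= (numerical_radius S)%:C * `|x| ^+ 2.
Proof.
move=> [M SM].
have [->|x0] := eqVneq x 0.
  by rewrite linear0r !normr0 expr0n mulr0.
have nx : `|x| != 0 by rewrite normr_eq0.
pose e := `|x|^-1 *: x.
have e1 : `|e| = 1 by rewrite normrZ normfV normr_id mulVf.
have -> : x = `|x| *: e by rewrite scalerA divff// scale1r.
rewrite [S _]linearZ/= linearZl_LR/= linearZr_LR/= mulrA !normrM norm_conjC.
rewrite normrZ e1 mulr1 !normr_id -expr2 mulrC ler_wpM2r ?exprn_ge0//.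
rewrite -Re_norm lecR; apply: ub_le_sup; last by exists e.
exists M => _ [y y1 <-]; rewrite -lecR Re_norm.
apply: (le_trans (norm_innerM _ _)).
by have := SM y; rewrite (y1 : `|y| = 1) !mulr1.
Qed.

Lemma opnorm_ge0 {R : realType} {H K : hilbertType R} (f : H -> K) :
  0 <= opnorm f.
Proof. by apply: sup_of_ge0 => _ [x _ <-]; exact: Re_norm_ge0. Qed.

Lemma norm_le_opnorm {R : realType} {H K : hilbertType R}
    (f : {linear H -> K}) (x : H) : bounded_operator f ->
  `|f x| <= (opnorm f)%:C * `|x|.
Proof.
move=> [M fM].
have [->|x0] := eqVneq x 0; first by rewrite linear0 !normr0 mulr0.
have nx : `|x| != 0 by rewrite normr_eq0.
pose e := `|x|^-1 *: x.
have e1 : `|e| = 1 by rewrite normrZ normfV normr_id mulVf.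
have -> : x = `|x| *: e by rewrite scalerA divff// scale1r.
rewrite linearZ/= !(normrZ `|x|) e1 mulr1 !normr_id mulrC ler_wpM2r//.
rewrite -Re_norm lecR; apply: ub_le_sup; last by exists e; rewrite //= e1.
have M0 : 0 <= M.
  have := fM e; rewrite e1 mulr1 -lecR; exact: le_trans.
exists M => _ [y /= y1 <-]; rewrite -lecR Re_norm.
by apply: (le_trans (fM _)); rewrite ler_piMr// ler0c.
Qed.

Lemma bounded_comp {R : realType} {H K L : hilbertType R}
    (f : {linear H -> K}) (g : {linear K -> L}) :
  bounded_operator f -> bounded_operator g -> bounded_operator (g \o f).
Proof.
move=> hf hg; exists (opnorm g * opnorm f) => x /=.
rewrite rmorphM/= -mulrA; apply: (le_trans (norm_le_opnorm _ _ hg)).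
by rewrite ler_wpM2l ?norm_le_opnorm// ler0c opnorm_ge0.
Qed.

(** The functional [<C _, v>] is bounded by [|C| |v|], and its value at [B v]
    is [<CBv, v>]; this is how the numerical radius of the product enters. *)
Lemma norm_off_diagonal_le {R : realType} {H1 H2 : hilbertType R}
    (B : {linear H2 -> H1}) (C : {linear H1 -> H2}) (u : H1) (v : H2) :
  bounded_operator B -> bounded_operator C ->
  `|inner (B v) u + inner (C u) v| ^+ 2 <=
  (opnorm B ^+ 2 + opnorm C ^+ 2 + 2 * numerical_radius (C \o B))%:C
  * (`|u| * `|v|) ^+ 2.
Proof.
move=> hB hC.
pose phi w : R[i] := inner (C w) v.
pose N : R[i] := (opnorm C)%:C ^+ 2 * `|v| ^+ 2.
have phiP : scalar phi by move=> a x y; rewrite /phi linearP linearPl.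
have N0 : 0 <= N by rewrite mulr_ge0 ?exprn_ge0// ler0c opnorm_ge0.
have phiN w : `|phi w| ^+ 2 <= N * inner w w.
  rewrite dot_normM /N mulrAC -!exprMn.
  rewrite ler_pXn2r ?nnegrE ?normr_ge0 ?mulr_ge0 ?ler0c ?opnorm_ge0//.
  by apply: (le_trans (norm_innerM _ _)); rewrite ler_wpM2r// norm_le_opnorm.
apply: (le_trans (dot_functional_sum_le inner phi N u (B v) phiP N0 phiN)).
rewrite !dot_normM exprMn mulrCA ler_wpM2l ?exprn_ge0//.
rewrite !rmorphD !rmorphXn/= !rmorphM/= rmorph_nat.
rewrite [leRHS]mulrDl [X in _ <= X + _]mulrDl /N lerD//.
  rewrite lerD2r -exprMn ler_pXn2r ?nnegrE ?mulr_ge0 ?ler0c ?opnorm_ge0//.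
  exact: norm_le_opnorm.
rewrite -mulrA ler_wpM2l//.
exact: (norm_inner_le_numerical_radius (C \o B) v (bounded_comp _ _ hB hC)).
Qed.

(** * The block operator *)

(** On the unit circle, [s^2 - t^2] and [2 s t] are the cosine and sine of the
    double angle.  Apart from the constant [(a + d) / 2] the form is therefore
    half the scalar product of [(a - d, k)] with a unit vector of the plane. *)
Lemma binary_quadratic_form_le {R : rcfType} (a d k s t : R) :
  s ^+ 2 + t ^+ 2 = 1 ->
  a * s ^+ 2 + d * t ^+ 2 + k * (s * t) <=
  2^-1 * (a + d + Num.sqrt ((a - d) ^+ 2 + k ^+ 2)).
Proof.
move=> st.
set q := (a - d) * (s ^+ 2 - t ^+ 2) + k * (2 * (s * t)).
have -> : a * s ^+ 2 + d * t ^+ 2 + k * (s * t) =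
    2^-1 * ((a + d) * (s ^+ 2 + t ^+ 2) + q) by rewrite /q; field.
rewrite st mulr1 ler_pM2l ?invr_gt0// lerD2l.
apply: (le_trans (ler_norm q)); rewrite -sqrtr_sqr ler_wsqrtr//.
have -> : (a - d) ^+ 2 + k ^+ 2 =
    ((a - d) ^+ 2 + k ^+ 2) * (s ^+ 2 + t ^+ 2) ^+ 2.
  by rewrite st expr1n mulr1.
(* Lagrange's identity: the defect in Cauchy-Schwarz is the square below. *)
rewrite -subr_ge0; set r := _ - _.
have -> : r = ((a - d) * (2 * (s * t)) - k * (s ^+ 2 - t ^+ 2)) ^+ 2.
  by rewrite /r /q; ring.
exact: sqr_ge0.
Qed.

Theorem theorem2p4 (R : realType) (H1 H2 : hilbertType R)
    (A : {linear H1 -> H1}) (B : {linear H2 -> H1})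
    (C : {linear H1 -> H2}) (D : {linear H2 -> H2})
    (hA : bounded_operator A) (hB : bounded_operator B)
    (hC : bounded_operator C) (hD : bounded_operator D) :
  numerical_radius (block_op A B C D) <=
  2^-1 * (numerical_radius A + numerical_radius D +
          Num.sqrt ((numerical_radius A - numerical_radius D) ^+ 2
                    + opnorm B ^+ 2 + opnorm C ^+ 2
                    + 2 * numerical_radius (C \o B))).
Proof.
set a := numerical_radius A; set d := numerical_radius D.
have a0 : 0 <= a by exact: numerical_radius_ge0.
have d0 : 0 <= d by exact: numerical_radius_ge0.
set k2 := opnorm B ^+ 2 + opnorm C ^+ 2 + 2 * numerical_radius (C \o B).
have k20 : 0 <= k2.
  by rewrite !addr_ge0 ?sqr_ge0// mulr_ge0// numerical_radius_ge0.
have -> : (a - d) ^+ 2 + opnorm B ^+ 2 + opnorm C ^+ 2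
    + 2 * numerical_radius (C \o B) = (a - d) ^+ 2 + Num.sqrt k2 ^+ 2.
  by rewrite sqr_sqrtr// /k2 !addrA.
set k := Num.sqrt k2; set rhs := 2^-1 * _.
have rhs0 : 0 <= rhs by rewrite mulr_ge0 ?invr_ge0// !addr_ge0 ?sqrtr_ge0.
rewrite /numerical_radius; set E := (X in sup X).
(* If both spaces are zero there is no unit vector, and the [sup] is 0. *)
have [->|E0] := eqVneq E set0; first by rewrite sup0.
apply: ge_sup; first exact/set0P.
move=> _ [x x1 <-].
pose s := complex.Re `|x.1|; pose t := complex.Re `|x.2|.
have sE : s%:C = `|x.1| by exact: Re_norm.
have tE : t%:C = `|x.2| by exact: Re_norm.
have st : s ^+ 2 + t ^+ 2 = 1.
  apply: (@complexI R); rewrite rmorphD !rmorphXn/= sE tE.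
  by rewrite -[LHS]sqrtCK -hsum_normE (x1 : `|x| = 1) expr1n.
apply: le_trans (binary_quadratic_form_le a d k s t st).
rewrite -lecR Re_norm !rmorphD/=.
rewrite [(a * _)%:C]rmorphM [(d * _)%:C]rmorphM [(k * _)%:C]rmorphM.
rewrite !rmorphXn/= rmorphM/= sE tE.
have -> : hsum_inner (block_op A B C D x) x =
    inner (A x.1) x.1 + inner (D x.2) x.2
    + (inner (B x.2) x.1 + inner (C x.1) x.2).
  rewrite [LHS](_ : _ =
    inner (A x.1 + B x.2) x.1 + inner (C x.1 + D x.2) x.2)//.
  by rewrite !linearDl/= [X in _ + X]addrC addrACA.
apply: (le_trans (ler_normD _ _)); apply: lerD.
  apply: (le_trans (ler_normD _ _)).
  exact: (lerD (norm_inner_le_numerical_radius A x.1 hA)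
    (norm_inner_le_numerical_radius D x.2 hD)).
have k0 : 0 <= k%:C by rewrite ler0c sqrtr_ge0.
rewrite -(@ler_pXn2r _ 2) ?nnegrE ?mulr_ge0// exprMn.
have -> : k%:C ^+ 2 = k2%:C by rewrite -rmorphXn/= /k sqr_sqrtr.
exact: norm_off_diagonal_le.
Qed.
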